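(* For any $k\ge 1$ such that $\sqrt{k}\le m^{1/(2k-1)}$, no $k$-query algorithm can compute an allocation that is $\omega\!\left(\frac{\sqrt{k}}{m^{1/(2k-1)}}\right)$-EFX.
   Context: There is a set $N=\{1,\dots,n\}$ of $n\ge 2$ agents and a set $G$ of $m\ge n$ goods. Each agent $i$ has a valuation function $v_i:G\to\mathbb{R}_{\ge 0}$, extended additively to bundles: $v_i(X)=\sum_{g\in X}v_i(g)$ for $X\subseteq G$. An allocation is a tuple $(X_i)_{i\in N}$ of pairwise disjoint (possibly empty) bundles with $\bigcup_i X_i=G$. For $\alpha\in[0,1]$, an allocation is $\alpha$-EFX if for all agents $i\ne j$ with $X_j\ne\varnothing$ and every $g\in X_j$, $v_i(X_i)\ge\alpha\cdot v_i(X_j\setminus\{g\})$. A ranking (strict linear order) $\succ_i$ of $G$ is consistent with $v_i$ if $g\succ_i g'$ implies $v_i(g)\ge v_i(g')$. A $k$-query algorithm receives as input rankings $(\succ_i)_{i\in N}$ consistent with the unknown valuations, may make $k$ value queries per agent, where a value query names an agent $i$ and a good $g$ and returns $v_i(g)$, and finally outputs an allocation. Its EFX guarantee must hold for all instances, i.e., regardless of the part of the valuations that is not revealed to it. *)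

(* Defs.v *)
From HB Require Import structures.
From mathcomp Require Import all_boot all_order all_algebra.
From mathcomp Require Import reals exp.

Set Implicit Arguments.
Unset Strict Implicit.
Unset Printing Implicit Defensive.

Import Order.TTheory GRing.Theory Num.Theory.
Local Open Scope ring_scope.

(* Agents are 'I_n and goods are 'I_m; [v i g] is the value of good g for
   agent i. *)

Definition bundle_value (R : realType) (n m : nat) (v : 'I_n -> 'I_m -> R)
    (i : 'I_n) (S : {set 'I_m}) : R :=
  \sum_(g in S) v i g.

Definition is_allocation (n m : nat) (X : 'I_n -> {set 'I_m}) : Prop :=
  (forall i j : 'I_n, i != j -> [disjoint X i & X j]) /\
  \bigcup_(i < n) X i = [set: 'I_m].

Definition alpha_EFX (R : realType) (n m : nat) (alpha : R)
    (v : 'I_n -> 'I_m -> R) (X : 'I_n -> {set 'I_m}) : Prop :=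
  forall i j : 'I_n, i != j -> X j != set0 ->
  forall g : 'I_m, g \in X j ->
    alpha * bundle_value v i (X j :\ g) <= bundle_value v i (X i).

(* [r g h] reads "g is ranked strictly above h". *)
Definition is_ranking (m : nat) (r : rel 'I_m) : Prop :=
  [/\ irreflexive r, transitive r
    & forall g h : 'I_m, g != h -> r g h \/ r h g].

Definition consistent (R : realType) (m : nat) (r : rel 'I_m)
    (u : 'I_m -> R) : Prop :=
  forall g h : 'I_m, r g h -> u h <= u g.

Definition is_instance (R : realType) (n m : nat) (r : 'I_n -> rel 'I_m)
    (v : 'I_n -> 'I_m -> R) : Prop :=
  forall i : 'I_n,
    [/\ is_ranking (r i), forall g : 'I_m, 0 <= v i g & consistent (r i) (v i)].

(* Deterministic adaptive querying: either stop with a tuple of bundles, or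
   query the value of good g for agent i and continue according to the answer.
   No computability restriction is put on the continuations. *)
Inductive query_tree (R : Type) (n m : nat) : Type :=
| Output of ('I_n -> {set 'I_m})
| Query of 'I_n & 'I_m & (R -> query_tree R n m).

Fixpoint run (R : Type) (n m : nat) (t : query_tree R n m)
    (v : 'I_n -> 'I_m -> R) : 'I_n -> {set 'I_m} :=
  match t with
  | Output X => X
  | Query i g next => run (next (v i g)) v
  end.

Fixpoint num_queries (R : Type) (n m : nat) (t : query_tree R n m)
    (v : 'I_n -> 'I_m -> R) (i : 'I_n) : nat :=
  match t with
  | Output _ => 0
  | Query j g next => ((j == i) + num_queries (next (v j g)) v i)%N
  end.

(* The rankings are known to the algorithm from the start; the valuations are
   accessible only through queries. *)
Definition algorithm (R : Type) (n m : nat) : Type :=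
  ('I_n -> rel 'I_m) -> query_tree R n m.

(* The query budget is imposed only on executions that can actually occur,
   i.e. those on answers coming from consistent valuations. *)
Definition k_query (R : realType) (n m k : nat) (A : algorithm R n m) : Prop :=
  forall (r : 'I_n -> rel 'I_m) (v : 'I_n -> 'I_m -> R), is_instance r v ->
  forall i : 'I_n, (num_queries (A r) v i <= k)%N.

Definition computes_EFX (R : realType) (n m : nat) (alpha : R)
    (A : algorithm R n m) : Prop :=
  forall (r : 'I_n -> rel 'I_m) (v : 'I_n -> 'I_m -> R), is_instance r v ->
    is_allocation (run (A r) v) /\ alpha_EFX alpha v (run (A r) v).

(* Main.v *)
(* All agents share one ranking. The n - 1 top goods are worth 1, the x-th good
   after them is worth c / x with c = alpha / (2k), and every query is answered
   accordingly; afterwards the adversary may still change one agent's unqueried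
   values. Some agent p gets no top good. Rounding the values of p down to the
   next queried good makes all low goods together worth at most c k < alpha, so
   every top good must be alone in its bundle and p must hold all low goods. An
   owner of a top good may have the values between two consecutive queried
   positions q < y rounded up to c / q, and those before the first query rounded
   to the value there; that p's bundle is not too attractive then bounds y / q
   by O(k / alpha^2), and the first gap by O(1 / alpha). As there are at most k
   gaps, the number of low goods is at most
   (3 / alpha) (4 k / alpha^2)^(k - 1), which is below m / 2 when
   alpha > 6 sqrt k / m^(1/(2k-1)). *)
Require Import Defs.
From mathcomp Require Import all_boot all_order all_algebra.
From mathcomp Require Import reals exp.
From mathcomp Require Import zify ring lra.

Import Order.TTheory GRing.Theory Num.Theory.
Local Open Scope ring_scope.

(** * Dependence of an execution on the queried values only *)

Fixpoint queried (R : Type) (n m : nat) (t : query_tree R n m)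
    (v : 'I_n -> 'I_m -> R) (i : 'I_n) : seq 'I_m :=
  match t with
  | Output _ => [::]
  | Query j g next =>
      let s := queried _ _ _ (next (v j g)) v i in if j == i then g :: s else s
  end.
Arguments queried {R n m} t v i.

Lemma size_queried (R : Type) (n m : nat) (t : query_tree R n m) v i :
  size (queried t v i) = num_queries t v i.
Proof. by elim: t => //= j g next IH; case: eqP => _ /=; rewrite IH. Qed.

(** Equal answers keep both executions on the same branch of the tree. This lets the adversary alter
    unqueried values after the run. *)
Lemma run_agree (R : Type) (n m : nat) (t : query_tree R n m)
    (v w : 'I_n -> 'I_m -> R) :
  (forall i g, g \in queried t v i -> w i g = v i g) -> run t w = run t v.
Proof.
elim: t => //= j g next IH vw.
have -> : w j g = v j g by apply: vw; rewrite eqxx mem_head.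
apply: IH => i h hq; apply: vw.
by case: eqP => _ //; rewrite inE hq orbT.
Qed.

Lemma card_ord_interval (m a b : nat) : (b <= m)%N ->
  #|[set g : 'I_m | (a <= g < b)%N]| = (b - a)%N.
Proof.
move=> bm.
rewrite cardsE -sum1_card -(big_mkord (fun i => (a <= i < b)%N) (fun=> 1%N)).
rewrite -[RHS]muln1 -sum_nat_const_nat (big_nat_widen a b m) //.
rewrite (big_nat_widenl a 0 m) //; apply: eq_bigl => i.
by rewrite andbC.
Qed.

(** * Multiplying the gap ratios along the queried positions *)

Section ChainBound.
Variables (R : realFieldType) (D : seq nat) (d0 : nat) (a b : R).

(** Descend from [Y], each time to the largest element of [D] below the current point. Every step
    costs a factor [b], except the last one, from [d0], which costs [a]. *)
Lemma gap_chain_bound (Y : nat) :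
  d0 \in D -> (forall d, d \in D -> (d0 <= d)%N) -> 1 <= b ->
  (forall y, (d0 < y)%N -> (y <= Y)%N ->
     (forall d, d \in D -> ~~ (d0 < d < y)%N) -> y%:R <= a) ->
  (forall q y, q \in D -> (d0 < q < y)%N -> (y <= Y)%N ->
     (forall d, d \in D -> ~~ (q < d < y)%N) -> y%:R <= q%:R * b) ->
  (d0 < Y)%N -> 0 <= a -> Y%:R <= a * b ^+ (size D).-1.
Proof.
move=> d0D d0min b1 first_gap gap d0Y a0.
(* Strong induction on [y], with [N] as fuel; the exponent counts the entries of [D] strictly
   between [d0] and [y]. *)
have chain N y : (y <= N)%N -> (d0 < y)%N -> (y <= Y)%N ->
    y%:R <= a * b ^+ count (fun d => (d0 < d < y)%N) D.
  elim: N y => [|N IH] y yN d0y yY; first by lia.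
  have exq : exists q, (q \in D) && (q < y)%N by exists d0; rewrite d0D.
  have bq q : (q \in D) && (q < y)%N -> (q <= y)%N by case/andP => _ /ltnW.
  case: (ex_maxnP exq bq) => q /andP[qD qy] qmax.
  have no_between d : d \in D -> ~~ (q < d < y)%N.
    by move=> dD; apply/negP => /andP[qd dy]; have := qmax d; rewrite dD dy; lia.
  have [q_d0|q_d0] := eqVneq q d0.
    rewrite q_d0 in no_between.
    apply: (le_trans (first_gap y d0y yY no_between)).
    by rewrite ler_peMr // exprn_ege1.
  have d0q : (d0 < q)%N by rewrite ltn_neqAle eq_sym q_d0 d0min.
  have yle : y%:R <= q%:R * b by apply: gap => //; rewrite d0q.
  apply: (le_trans yle).
  have qle := IH q (leq_trans qy yN) d0q (ltnW (leq_trans qy yY)).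
  have b0 : 0 <= b by apply: le_trans b1.
  apply: (le_trans (ler_wpM2r b0 qle)).
  rewrite -mulrA -exprSr ler_wpM2l // ler_weXn2l //.
  (* The entry [q] is counted for [y] but not for [q], which pays for the extra factor [b]. *)
  have -> : (count (fun d => (d0 < d < q)%N) D).+1 =
     (count (fun d => (d0 < d < q)%N) D + 1)%N by rewrite addn1.
  have q1 : (1 <= count (pred1 q) D)%N by rewrite -has_count has_pred1.
  apply: (@leq_trans (count (predU (fun d => (d0 < d < q)%N) (pred1 q)) D)).
    have := count_predUI (fun d => (d0 < d < q)%N) (pred1 q) D.
    rewrite (@eq_count _ (predI _ _) pred0) ?count_pred0 => [|d /=]; last first.
      by case: eqP => [->|]; rewrite ?ltnn ?andbF.
    by rewrite addn0 => ->; rewrite leq_add2l.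
  by apply: sub_count => d /= ; case: eqP => [->|_]; lia.
apply: (le_trans (chain Y Y (leqnn _) d0Y (leqnn _))).
rewrite ler_wpM2l // ler_weXn2l //.
(* The entry [d0] is never counted, hence the predecessor in the exponent. *)
have d01 : (1 <= count (pred1 d0) D)%N by rewrite -has_count has_pred1.
apply: (@leq_trans (count (predC (pred1 d0)) D)).
  by apply: sub_count => d /=; lia.
rewrite -(count_predC (pred1 d0) D).
by case: (count (pred1 d0) D) d01 => // c _; rewrite addSn leq_addl.
Qed.

End ChainBound.

(** * Value profiles by position, and what they force on the bundles *)

Section Rows.
Variables (R : realFieldType) (c : R).
Hypotheses (c_gt0 : 0 < c) (c_le1 : c <= 1).

(* Good g is at position g - (n - 2), truncated at 0, so that the n - 1 top
   goods share position 0 and the others are at positions 1, 2, ... *)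
Definition level (x : nat) : R := if x == 0%N then 1 else c / x%:R.

Lemma level_gt0 x : 0 < level x.
Proof. by rewrite /level; case: x => //= x; rewrite divr_gt0. Qed.

Lemma level_anti x y : (x <= y)%N -> level y <= level x.
Proof.
rewrite /level; case: x => [|x]; case: y => [|y] //= xy.
  by rewrite ler_pdivrMr // mul1r (le_trans c_le1) // ler1n.
by rewrite ler_pM2l // lef_pV2 ?posrE // ler_nat.
Qed.

Lemma level_le1 x : level x <= 1.
Proof. by rewrite -[leRHS]/(level 0) level_anti. Qed.

(** The profiles that the adversary may substitute for one agent's values when [D] contains the
    positions queried for that agent. *)
Definition valid_row (D : seq nat) (f : nat -> R) : Prop :=
  [/\ forall x, 0 <= f x, forall x y, (x <= y)%N -> f y <= f x
    & {in D, f =1 level}].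

(* A maximum over the queried d >= x is the value of the next queried good; it
   is 0 after the last one. *)
Definition low_row (D : seq nat) (x : nat) : R :=
  if x == 0%N then 1 else \big[Num.max/0]_(d <- D | (x <= d)%N) level d.

Lemma low_row_valid D : valid_row D (low_row D).
Proof.
have bigmax0 (x : nat) : 0 <= \big[Num.max/0]_(d <- D | (x <= d)%N) level d.
  by elim/big_ind: _ => // [a b a0 b0|d _]; rewrite ?le_max ?a0 // ltW ?level_gt0.
split.
- by move=> x; rewrite /low_row; case: eqP.
- move=> x y xy; rewrite /low_row.
  have [x0|x0] := eqVneq x 0%N.
    case: eqP => // _; elim/big_ind: _ => // [a b a1 b1|d _].
      by rewrite ge_max a1.
    exact: level_le1.
  have [y0|y0] := eqVneq y 0%N; first by lia.
  rewrite big_seq_cond; elim/big_ind: _ => // [a b ax bx|d /andP[dD yd]].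
    by rewrite ge_max ax.
  by apply: le_bigmax_seq => //; apply: leq_trans yd.
- move=> x xD; rewrite /low_row.
  have [->|x0] := eqVneq x 0%N; first by [].
  apply: le_anti; apply/andP; split; last exact: le_bigmax_seq.
  elim/big_ind: _ => // [|a b ax bx|d xd]; first exact/ltW/level_gt0.
    by rewrite ge_max ax.
  exact: level_anti.
Qed.

(** Bound the maximum by a sum and exchange the sums: a queried [d > 0] contributes [c / d] for each
    of at most [d] goods at positions 1 to [d], hence at most [c]; [d = 0] contributes nothing. *)
Lemma low_row_sum (m N : nat) (D : seq nat) (S : {set 'I_m}) :
  {in D, forall d, (d + N < m)%N} -> {in S, forall g : 'I_m, (N < g)%N} ->
  \sum_(g in S) low_row D (g - N) <= c * (size D)%:R.
Proof.
move=> Dm SN.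
apply: (@le_trans _ _ (\sum_(g in S) \sum_(d <- D | (g - N <= d)%N) level d)).
  apply: ler_sum => g gS; rewrite /low_row subn_eq0 leqNgt SN //=.
  elim: {Dm} D => [|d D IH]; first by rewrite !big_nil.
  rewrite !big_cons; case: ifP => // _.
  rewrite ge_max lerDl sumr_ge0 => [|i _]; last exact/ltW/level_gt0.
  by rewrite (le_trans IH) // lerDr ltW // level_gt0.
rewrite (exchange_big_dep predT) //=.
have -> : c * (size D)%:R = \sum_(d <- D) c.
  by rewrite big_const_seq count_predT iter_addr_0 mulr_natr.
rewrite big_seq [leRHS]big_seq; apply: ler_sum => d dD.
have -> : \sum_(g in S | (g - N <= d)%N) level d =
    \sum_(g in [set g in S | (g - N <= d)%N]) level d.
  by apply: eq_bigl => g; rewrite inE.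
rewrite sumr_const -mulr_natr /level.
have cardS : (#|[set g in S | (g - N <= d)%N]| <= d)%N.
  rewrite -[leqRHS]subn0 -(subnDr N.+1 d 0) add0n -(@card_ord_interval m); last first.
    by have := Dm _ dD; lia.
  by apply/subset_leq_card/subsetP => g; rewrite !inE => /andP[/SN gN gd]; lia.
case: eqP => [d0|/eqP d0].
  by move: cardS; rewrite d0 leqn0 => /eqP ->; rewrite mulr0 ltW.
by rewrite -mulrA ger_pMr // ler_pdivrMl ?mulr1 ?ler_nat // ltr0n lt0n.
Qed.

(* The case x < d0 matters only when no top good is queried: the value of the
   top goods then drops to that of the first queried good d0. *)
Definition plateau (d0 q y x : nat) : nat :=
  maxn d0 (if (q <= x < y)%N then q else x).

Lemma plateau_zero d0 q y : (d0 <= q)%N -> plateau d0 q y 0 = d0.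
Proof. by rewrite /plateau; case: ifP; lia. Qed.

Lemma plateau_mid d0 q y x :
  (d0 <= q)%N -> (q <= x < y)%N -> plateau d0 q y x = q.
Proof. by rewrite /plateau => d0q ->; apply/maxn_idPr. Qed.

Lemma plateau_first d0 y x : (x < y)%N -> plateau d0 d0 y x = d0.
Proof. by rewrite /plateau; case: ifP; lia. Qed.

(** The map [plateau d0 q y] is nondecreasing and fixes all of [D], as it moves only positions below
    [d0] or strictly between [q] and [y]. *)
Lemma plateau_row_valid (D : seq nat) d0 q y :
  (d0 <= q)%N -> {in D, forall d, (d0 <= d)%N /\ ~~ (q < d < y)%N} ->
  valid_row D (fun x => level (plateau d0 q y x)).
Proof.
move=> d0q Dgap; split.
- by move=> x; apply/ltW/level_gt0.
- move=> x z xz; apply: level_anti; rewrite /plateau.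
  by case: ifP; case: ifP; lia.
- move=> d dD; have [d0d gap] := Dgap _ dD.
  by rewrite /plateau; case: ifP => h; congr level; lia.
Qed.

Lemma interval_sum_ge (m N a b : nat) (f : nat -> R) (t : R) (S : {set 'I_m}) :
  (0 < a)%N -> (b + N <= m)%N -> (forall x, 0 <= f x) ->
  (forall x, (a <= x < b)%N -> t <= f x) ->
  (forall g : 'I_m, (a <= g - N < b)%N -> g \in S) ->
  (b - a)%:R * t <= \sum_(g in S) f (g - N)%N.
Proof.
move=> a0 bm f0 ft inS.
(* As [a > 0], truncated subtraction does no harm and each position in the interval belongs to
   exactly one good. *)
pose I := [set g : 'I_m | (a + N <= g < b + N)%N].
have -> : (b - a)%:R * t = \sum_(g in I) t.
  by rewrite sumr_const card_ord_interval // subnDr mulr_natl.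
apply: (@le_trans _ _ (\sum_(g in I) f (g - N)%N)).
  by apply: ler_sum => g; rewrite inE => gI; apply: ft; lia.
have IS : I \subset S by apply/subsetP => g; rewrite inE => gI; apply: inS; lia.
by rewrite [leRHS](big_setID I) /= (setIidPr IS) lerDl sumr_ge0.
Qed.

(** Meant for the owner of a single top good, worth [f 0], who compares it with [S], the bundle of
    low goods less its last one. Each plateau row turns this comparison into a bound on one gap of
    [D]. *)
Lemma few_queries_bound (m N M : nat) (alpha : R) (D : seq nat)
    (S : {set 'I_m}) :
  0 < alpha -> (M + N < m)%N -> D != [::] -> {in D, forall d, (d <= M)%N} ->
  (forall g : 'I_m, (0 < g - N < M)%N -> g \in S) ->
  (forall f, valid_row D f -> alpha * \sum_(g in S) f (g - N)%N <= f 0%N) ->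
  M.+1%:R <= (2 + alpha^-1) * (2 + (c * alpha)^-1) ^+ (size D).-1.
Proof.
move=> alpha0 Mm D0 DM inS ineq.
have exd : exists d, d \in D by case: (D) D0 => // d s _; exists d; rewrite mem_head.
case: (ex_minnP exd) => d0 d0D d0min.
have a1 : 0 < alpha^-1 by rewrite invr_gt0.
have ca0 : 0 < (c * alpha)^-1 by rewrite invr_gt0 mulr_gt0.
apply: (@gap_chain_bound _ D d0) => //; try lra.
- move=> y d0y yM gap.
  (* Here [y] can be [M + 1], while [S] is only known to contain positions 1 to [M - 1]; so the
     plateau is summed only below [y - 1]. *)
  have yMm : (y.-1 + N <= m)%N by lia.
  have ylt x : (1 <= x < y.-1)%N -> (x < y)%N by lia.
  have yin (g : 'I_m) : (1 <= g - N < y.-1)%N -> (0 < g - N < M)%N by lia.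
  have y_split : (y <= y.-1 - 1 + 2)%N by lia.
  pose f x := level (plateau d0 d0 y x).
  have fv : valid_row D f.
    by apply: plateau_row_valid => // d dD; split; [apply: d0min | apply: gap].
  have f_sum : (y.-1 - 1)%:R * level d0 <= \sum_(g in S) f (g - N)%N.
    apply: interval_sum_ge => // [x|x /ylt xy|g /yin]; last exact: inS.
      exact/ltW/level_gt0.
    by rewrite /f plateau_first.
  have := ineq _ fv; rewrite {2}/f plateau_zero // => f_efx.
  have : alpha * (y.-1 - 1)%:R <= 1.
    rewrite -(ler_pM2r (level_gt0 d0)) mul1r -mulrA; apply: le_trans f_efx.
    by rewrite ler_pM2l.
  rewrite -ler_pdivlMl // mulr1.
  move: y_split; rewrite -(ler_nat R) natrD; move: ((y.-1 - 1)%:R).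
  by move=> u; clear; lra.
- move=> q y qD /andP[d0q qy] yM gap.
  have q_gt0 : (0 < q)%N by lia.
  have yMm : (y.-1 + N <= m)%N by lia.
  have ylt x : (q <= x < y.-1)%N -> (q <= x < y)%N by lia.
  have yin (g : 'I_m) : (q <= g - N < y.-1)%N -> (0 < g - N < M)%N by lia.
  have y_split : (y <= y.-1 - q + q + 1)%N by lia.
  pose f x := level (plateau d0 q y x).
  have fv : valid_row D f.
    apply: plateau_row_valid => [|d dD]; first exact: ltnW.
    by split; [apply: d0min | apply: gap].
  have f_sum : (y.-1 - q)%:R * level q <= \sum_(g in S) f (g - N)%N.
    apply: interval_sum_ge => // [x|x /ylt xy|g /yin]; last exact: inS.
      exact/ltW/level_gt0.
    by rewrite /f plateau_mid // ltnW.
  have := ineq _ fv; rewrite {2}/f plateau_zero 1?ltnW // => f_efx.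
  have q0 : 0 < q%:R :> R by rewrite ltr0n.
  have : (y.-1 - q)%:R * (c * alpha) <= q%:R.
    rewrite -[leRHS]mul1r -ler_pdivrMr //.
    have := le_trans f_efx (level_le1 d0).
    apply: le_trans.
    have -> : (y.-1 - q)%:R * (c * alpha) / q%:R =
        alpha * ((y.-1 - q)%:R * level q).
      by rewrite /level gtn_eqF //; ring.
    by rewrite ler_pM2l.
  (* This gives [y <= q + 1 + q / (c * alpha)], and [1 <= q] absorbs the 1 into the factor
     [2 + (c * alpha)^-1]. *)
  rewrite -ler_pdivlMr ?mulr_gt0 // mulrDr.
  move: y_split q_gt0; rewrite -(ler_nat R) !natrD -(ler1n R).
  move: ((y.-1 - q)%:R) (q%:R / _); clear.
  by move=> u w; lra.
- by have := DM _ d0D; lia.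
Qed.

End Rows.

Arguments level {R} c x.
Arguments valid_row {R} c D f.
Arguments low_row {R} c D x.
Arguments low_row_valid {R c}.
Arguments low_row_sum {R c} _ _ {m N D S}.

(** * Comparison of the resulting bound with [m / 2] *)

(** With [k = j + 1], [s] the root of [k] and [x] the inverse of [alpha], the hypothesis gives
    [(6 * s * x) ^+ (2j + 1) < m]. The left side is [6 * s * x * (36 * k * x^2) ^+ j], while
    [2 + x <= 3 * s * x] and [2 + 2 * k * x^2 <= 36 * k * x^2]. *)
Lemma threshold_bound (R : realType) (m k : nat) (alpha : R) :
  (0 < m)%N -> (0 < k)%N -> 0 < alpha <= 1 ->
  6 * (Num.sqrt k%:R / m%:R `^ ((2 * k%:R - 1)^-1)) < alpha ->
  (2 + alpha^-1) * (2 + (alpha / (2 * k%:R) * alpha)^-1) ^+ k.-1 < m%:R / 2.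
Proof.
case: k => // j m0 _ /andP[alpha0 alpha1].
set s := Num.sqrt _; set mu := _ `^ _ => lt_alpha.
set kk : R := j.+1%:R in s mu lt_alpha *.
have kk1 : 1 <= kk by rewrite ler1n.
have s1 : 1 <= s by rewrite -sqrtr1 ler_wsqrtr.
have ss : s ^+ 2 = kk by rewrite sqr_sqrtr // (le_trans ler01).
have mu0 : 0 < mu by rewrite powR_gt0 // ltr0n.
have mu_exp : mu ^+ (j.*2.+1) = m%:R.
  rewrite -powR_mulrn ?ltW // /mu -powRrM.
  have -> : 2 * kk - 1 = j.*2.+1%:R.
    by rewrite /kk -!natr1 -mul2n natrM; ring.
  by rewrite mulVf ?pnatr_eq0 // powRr1.
have -> : (alpha / (2 * kk) * alpha)^-1 = 2 * kk * alpha^-1 ^+ 2.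
  by field; rewrite gt_eqF // nat1r pnatr_eq0.
have xs_lt : 6 * s * alpha^-1 < mu.
  by rewrite ltr_pdivrMr // -ltr_pdivrMl // mulrC -mulrA.
set x := alpha^-1 in xs_lt *.
have x1 : 1 <= x by rewrite invf_ge1.
have x0 : 0 <= x by apply: le_trans x1.
have s0 : 0 <= s by apply: le_trans s1.
have kx1 : 1 <= kk * x ^+ 2 by rewrite mulr_ege1 // exprn_ege1.
have pow_lt : (6 * s * x) ^+ (j.*2.+1) < m%:R.
  by rewrite -mu_exp ltrXn2r // !mulr_ge0 // ler0n.
have pow_eq : (6 * s * x) ^+ (j.*2.+1) = 6 * s * x * (36 * (kk * x ^+ 2)) ^+ j.
  rewrite exprS -mul2n exprM; congr (_ * _ ^+ _).
  by rewrite -ss; ring.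
rewrite ltr_pdivlMr // mulrC; apply: le_lt_trans pow_lt; rewrite pow_eq.
have -> : 6 * s * x * (36 * (kk * x ^+ 2)) ^+ j =
    2 * (3 * s * x * (36 * (kk * x ^+ 2)) ^+ j) by ring.
rewrite ler_pM2l //; apply: ler_pM.
- by move: x0; clear; lra.
- by apply: exprn_ge0; move: kx1; rewrite -mulrA; move: (kk * _); clear => u; lra.
- have : x <= s * x by rewrite ler_peMl.
  by rewrite -mulrA; move: (s * x) x1; clear => u; lra.
- apply: lerXn2r; rewrite ?nnegrE; move: kx1; rewrite -?mulrA;
    move: (kk * _); clear => u; lra.
Qed.

(** * The adversary against a given algorithm *)

Lemma position_instance (R : realType) (n m N : nat) (f : 'I_n -> nat -> R) :
  (forall i x, 0 <= f i x) ->
  (forall i x y, (x <= y)%N -> f i y <= f i x) ->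
  is_instance (fun _ => (fun g h : 'I_m => (g < h)%N)) (fun i g => f i (g - N)%N).
Proof.
move=> f0 f_anti i; split=> // [|g h gh].
  split=> [g|g h l|g h]; [exact: ltnn|exact: ltn_trans|].
  by rewrite -val_eqE neq_ltn => /orP.
by apply/f_anti/leq_sub2r/ltnW.
Qed.

Theorem theorem3p3 (R : realType) :
  exists C : R, 0 < C /\
  forall n : nat, (2 <= n)%N ->
  exists m0 : nat,
  forall m k : nat, (n <= m)%N -> (m0 <= m)%N -> (1 <= k)%N ->
    Num.sqrt k%:R <= m%:R `^ ((2 * k%:R - 1)^-1) :> R ->
  forall alpha : R, 0 <= alpha <= 1 ->
    C * (Num.sqrt k%:R / m%:R `^ ((2 * k%:R - 1)^-1)) < alpha ->
    ~ exists A : algorithm R n m, k_query k A /\ computes_EFX alpha A.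
Proof.
exists 6; split=> // n n2; exists (2 * n)%N => m k nm m2n k0 _ alpha.
case/andP=> _ alpha1 lt_alpha [A [A_k A_efx]].
have alpha0 : 0 < alpha.
  by apply: le_lt_trans lt_alpha; rewrite mulr_ge0 // divr_ge0 ?sqrtr_ge0 ?powR_ge0.
have m_gt0 : (0 < m)%N by lia.
have k1 : 1 <= k%:R :> R by rewrite ler1n.
have k_gt0 : 0 < k%:R :> R by rewrite ltr0n.
have alpha_int : 0 < alpha <= 1 by rewrite alpha0.
have M_small := @threshold_bound R m k alpha m_gt0 k0 alpha_int lt_alpha.
(* Chosen so that [c * k] is [alpha / 2], strictly below [alpha]. *)
pose c := alpha / (2 * k%:R).
have c0 : 0 < c by rewrite divr_gt0 // mulr_gt0.
have c1 : c <= 1 by rewrite ler_pdivrMr ?mulr_gt0 //; lra.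
have [N nE] : exists N, n = N.+2 by exists (n - 2)%N; lia.
pose M := (m - N.+1)%N.
have m_M : m = (M + N.+1)%N by rewrite /M; lia.
have last_pos : (m.-1 - N)%N = M by rewrite /M; lia.
have m_2M : (m <= M.+1 * 2)%N by lia.
have Nm : (N.+1 < m)%N by lia.
pose r := fun _ : 'I_n => (fun g h : 'I_m => (g < h)%N).
pose v := fun (_ : 'I_n) (g : 'I_m) => level c (g - N)%N.
have v_inst : is_instance r v.
  apply: (@position_instance _ _ _ N (fun _ => level c)) => [_ x|_ x y].
    exact/ltW/level_gt0.
  exact: level_anti.
pose X := run (A r) v.
pose Q i := queried (A r) v i.
(* Without queries, position 0 is added as if queried: [D i] stays nonempty, and its size is still
   at most [k] because [1 <= k]. *)
pose D i := if Q i is [::] then [:: 0%N] else [seq (val g - N)%N | g <- Q i].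
have D0 i : D i != [::] by rewrite /D; case: (Q i).
have size_D i : (size (D i) <= k)%N.
  have := A_k r v v_inst i; rewrite -size_queried -/(Q i) /D.
  by case: (Q i) => //= g s; rewrite size_map.
have DM i : {in D i, forall d, (d <= M)%N}.
  move=> d; have : {in [seq (val g - N)%N | g <- Q i], forall e, (e <= M)%N}.
    move=> e /mapP[g _ ->].
    by rewrite leq_subLR -ltnS -addSn addnC -m_M ltn_ord.
  by rewrite /D; case: (Q i) => [|g s] //; [rewrite inE => _ /eqP -> | apply].
have Q_D i g : g \in Q i -> (g - N)%N \in D i.
  move=> gQ; have : (val g - N)%N \in [seq (val h - N)%N | h <- Q i].
    exact: map_f.
  by rewrite /D; case: (Q i) gQ.
have X_alloc : is_allocation X by have [] := A_efx r v v_inst.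
(* Only the row of [i] is replaced by [f]; the execution, and so [X], stays the same, and the
   guarantee applies to the altered instance. *)
have efx_row i f : valid_row c (D i) f -> forall j h, i != j -> h \in X j ->
    alpha * \sum_(g in X j :\ h) f (g - N)%N <= \sum_(g in X i) f (g - N)%N.
  move=> [f0 f_anti fD] j h ij hj.
  pose F i' := if i' == i then f else level c.
  pose w := fun i' (g : 'I_m) => F i' (g - N)%N.
  have w_inst : is_instance r w.
    apply: (@position_instance _ _ _ N F) => [i' x|i' x y]; rewrite /F; case: eqP => // _.
    - exact/ltW/level_gt0.
    - exact: f_anti.
    - exact: level_anti.
  have run_w : run (A r) w = X.
    apply: run_agree => i' g gQ; rewrite /w /F /v; case: eqP => // i'i.
    by apply: fD; rewrite -i'i; apply: Q_D.
  have [_] := A_efx r w w_inst; rewrite run_w => /(_ i j ij) efx.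
  have Xj0 : X j != set0 by apply/set0Pn; exists h.
  by have := efx Xj0 h hj; rewrite /bundle_value /w /F eqxx.
have [X_disj X_cover] := X_alloc.
have ex_owner g : exists i, g \in X i.
  have : g \in \bigcup_(i < n) X i by rewrite X_cover inE.
  by case/bigcupP => i _ gi; exists i.
pose own g := sval (sigW (ex_owner g)).
have own_in g : g \in X (own g) by rewrite /own; case: sigW.
have own_eq g i : g \in X i -> own g = i.
  move=> gi; apply/eqP/negPn/negP => /X_disj/disjointFr/(_ (own_in g)).
  by rewrite gi.
pose T := [set g : 'I_m | (g < N.+1)%N].
have card_T : #|T| = N.+1 by rewrite -[RHS]subn0 -(@card_ord_interval m) // ltnW.
have card_C : #|~: (own @: T)| = (N.+2 - #|own @: T|)%N.
  by rewrite cardsCs setCK card_ord; congr (_ - _)%N.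
(* The [n - 1] top goods have at most [n - 1] owners. *)
have [p pT] : exists p, p \in ~: (own @: T).
  apply/set0Pn; rewrite -card_gt0 card_C subn_gt0 ltnS -card_T.
  exact: leq_imset_card.
have own_p g : g \in T -> own g != p.
  move=> gT; apply: contraTneq pT => <-; rewrite inE negbK; exact: imset_f.
have Xp_low : {in X p, forall g : 'I_m, (N < g)%N}.
  move=> g /own_eq gp; rewrite ltnNge; apply/negP => gN.
  by have := own_p g; rewrite inE ltnS gN gp eqxx => /(_ isT).
(* If a top good [g] shares its bundle with some [h], removing [h] leaves at least 1 in the eyes of
   [p], whose own bundle is worth at most [alpha / 2] under [low_row]. *)
have [/existsP[g /andP[gT Xg]] | single] :=
  boolP [exists g, (g \in T) && (X (own g) != [set g])].
  have [h hX hg] : exists2 h, h \in X (own g) & h != g.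
    apply/exists_inP; apply: contraR Xg => /exists_inPn all_g.
    apply/eqP/setP => h; rewrite inE; apply/idP/eqP => [/all_g/negPn/eqP //|->].
    exact: own_in.
  have pj : p != own g by rewrite eq_sym own_p.
  have := efx_row p _ (low_row_valid c0 c1 (D p)) (own g) h pj hX.
  have DNm : {in D p, forall d, (d + N < m)%N}.
    by move=> d /DM; rewrite m_M addnS ltnS leq_add2r.
  move=> /le_trans/(_ (low_row_sum c0 c1 DNm Xp_low)).
  have gh : g \in X (own g) :\ h by rewrite !inE eq_sym hg own_in.
  rewrite (big_setD1 g gh) /=.
  have -> : (g - N)%N = 0%N by move: gT; rewrite inE ltnS => /eqP.
  rewrite [low_row _ _ 0]/low_row eqxx.
  have : 0 <= \sum_(i in X (own g) :\ h :\ g) low_row c (D p) (i - N)%N.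
    by apply: sumr_ge0 => i _; case: (low_row_valid c0 c1 (D p)).
  have ck : c * (size (D p))%:R <= alpha / 2.
    have -> : alpha / 2 = c * k%:R by rewrite /c; field; rewrite gt_eqF.
    by rewrite ler_pM2l // ler_nat.
  move: (\sum_(i in _) _) => rest rest0 /le_trans/(_ ck).
  rewrite mulrDr mulr1; have := mulr_ge0 (ltW alpha0) rest0; lra.
have {}single g : g \in T -> X (own g) = [set g].
  move=> gT; apply/eqP; have := forallP (etrans (esym (negb_exists _)) single) g.
  by rewrite gT negbK.
have own_inj : {in T &, injective own}.
  by move=> g h gT hT gh; apply: set1_inj; rewrite -!single // gh.
(* The top goods have [n - 1] distinct owners, so [p] is the only other agent; no owner has room for
   a low good. *)
have owner_p g : g \notin T -> own g = p.
  move=> gT; have /eqP/cards1P[q C_q] : #|~: (own @: T)| = 1%N.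
    by rewrite card_C card_in_imset // card_T subSnn.
  have own_C : own g \in ~: (own @: T).
    rewrite inE; apply: contra gT => /imsetP[h hT gh].
    by have := own_in g; rewrite gh single // inE => /eqP ->.
  by move: pT own_C; rewrite C_q !inE => /eqP -> /eqP.
pose g0 : 'I_m := Ordinal m_gt0.
have last_m : (m.-1 < m)%N by rewrite prednK.
pose gl : 'I_m := Ordinal last_m.
have g0T : g0 \in T by rewrite inE.
have gl_p : gl \in X p by rewrite -(owner_p gl) ?own_in // inE -leqNgt; clear -Nm; rewrite /=; lia.
(* Any top good would do in place of [g0]. Removing the last good [gl], at position [M], leaves
   positions 1 to [M - 1] with [p]. *)
have bound := @few_queries_bound R c c0 c1 m N M alpha (D (own g0)) (X p :\ gl).
have : M.+1%:R <= (2 + alpha^-1) * (2 + (c * alpha)^-1) ^+ (size (D (own g0))).-1.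
  apply: bound => //.
  - by rewrite m_M addnS.
  - move=> g gM; rewrite !inE; apply/andP; split.
      by apply: contraTneq gM => -> /=; rewrite last_pos ltnn andbF.
    by rewrite -(owner_p g) ?own_in // inE; clear -gM; lia.
  - move=> f fv; have := efx_row _ f fv p gl (own_p _ g0T) gl_p.
    by rewrite single // big_set1.
apply/negP; rewrite -ltNge.
have b1 : 1 <= 2 + (c * alpha)^-1.
  by have : 0 < (c * alpha)^-1; [rewrite invr_gt0 mulr_gt0 | clear; lra].
apply: (@le_lt_trans _ _ ((2 + alpha^-1) * (2 + (c * alpha)^-1) ^+ k.-1)).
  rewrite ler_wpM2l ?addr_ge0 ?invr_ge0 ?ler0n ?(ltW alpha0) //.
  by rewrite ler_weXn2l // -!subn1 leq_sub2r.
apply: (lt_le_trans M_small).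
by rewrite ler_pdivrMr // -natrM ler_nat.
Qed.
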